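(* Let $n,m,\bar h,T$ be positive integers with $T>\bar h$, let $h_1,h_2\in\{0,\dots,\bar h\}$ be known constant delays, and let input and state data $u(-\bar h),\dots,u(T)\in\mathbb{R}^m$, $x(-\bar h),\dots,x(T)\in\mathbb{R}^n$ be recorded from the system $$x(k+1)=A_0x(k)+A_1x(k-h_1)+Bu(k-h_2),$$ with constant unknown $A_0,A_1\in\mathbb{R}^{n\times n}$, $B\in\mathbb{R}^{n\times m}$. Let $U_{h_2,\{0\}}$, $X_{\{1\}}$ and $W_0\in\mathbb{R}^{(m+2n)\times T}$ be the data matrices defined in the context. For a feedback control $u(k)=Kx(k)$ with $K\in\mathbb{R}^{m\times n}$ consider the closed-loop system $$x(k+1)=\begin{bmatrix}BK & A_1 & A_0\end{bmatrix}\begin{bmatrix}x(k-h_2)\\ x(k-h_1)\\ x(k)\end{bmatrix}\qquad(1)$$ and the system $$x(k+1)=X_{\{1\}}G_K\begin{bmatrix}x(k-h_2)\\ x(k-h_1)\\ x(k)\end{bmatrix},\qquad(2)$$ where $G_K$ is a $T\times 3n$ matrix satisfying $$\begin{bmatrix}K & 0 & 0\\ 0 & I_n & 0\\ 0 & 0 & I_n\end{bmatrix}=W_0G_K.\qquad(3)$$ Then the following are equivalent: (i) for every $K\in\mathbb{R}^{m\times n}$ a matrix $G_K$ satisfying (3) exists and, for any such $G_K$, the trajectories of (1) and (2) are equivalent; (ii) $\mathrm{rank}(W_0)=m+2n$. In particular, one has $$u(k)=U_{h_2,\{0\}}G_K\begin{bmatrix}I_n & 0 & 0\end{bmatrix}^\top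 x(k).$$
   Context: Data matrices: $U_{h_2,\{0\}}=[u(-h_2)\ u(1-h_2)\ \cdots\ u(T-1-h_2)]\in\mathbb{R}^{m\times T}$, $X_{h_1,\{0\}}=[x(-h_1)\ \cdots\ x(T-1-h_1)]\in\mathbb{R}^{n\times T}$, $X_{\{0\}}=[x(0)\ \cdots\ x(T-1)]\in\mathbb{R}^{n\times T}$, $X_{\{1\}}=[x(1)\ \cdots\ x(T)]\in\mathbb{R}^{n\times T}$, and $$W_0=\begin{bmatrix}U_{h_2,\{0\}}\\ X_{h_1,\{0\}}\\ X_{\{0\}}\end{bmatrix}.$$ The recorded data satisfy the open-loop dynamics for $k=0,\dots,T-1$, i.e. $X_{\{1\}}=[B\ A_1\ A_0]W_0$. Two (autonomous, delayed) systems have equivalent trajectories if for every initial history $x(j)\in\mathbb{R}^n$, $j\in\mathbb{Z}\cap[-\bar h,0]$, they generate the same sequence $x(k)$, $k\geq 0$. *)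

(* Defs.v *)
From mathcomp Require Import all_boot all_order all_algebra.
From mathcomp Require Import reals.

Set Implicit Arguments.
Unset Strict Implicit.
Unset Printing Implicit Defensive.

Import Order.TTheory GRing.Theory Num.Theory.
Local Open Scope ring_scope.

(* Signals are total functions on int, so that negative times are available;
   the notions below only read them on the finite or half-infinite time
   windows that matter. *)

Section Delayed.
Variable R : realType.

(* The matrix [z(s)  z(1 + s)  ...  z(T - 1 + s)], whose time shift s is minus
   the delay. *)
Definition data_mx (p T : nat) (z : int -> 'cV[R]_p) (s : int) : 'M[R]_(p, T) :=
  \matrix_(i < p, t < T) z (t%:Z + s) i 0.

(* The vector [x(k - h2); x(k - h1); x(k)]. *)
Definition delayed_state (n h1 h2 : nat) (x : int -> 'cV[R]_n) (k : int) :
    'cV[R]_(n + n + n) :=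
  col_mx (col_mx (x (k - h2%:Z)) (x (k - h1%:Z))) (x k).

(* x solves x(k+1) = M [x(k - h2); x(k - h1); x(k)] for all k >= 0, with
   initial history phi on the integers of [-hbar, 0]. *)
Definition generates (n hbar h1 h2 : nat) (M : 'M[R]_(n, n + n + n))
    (phi x : int -> 'cV[R]_n) : Prop :=
  (forall j : int, - hbar%:Z <= j <= 0 -> x j = phi j) /\
  (forall k : nat, x (k%:Z + 1) = M *m delayed_state h1 h2 x k%:Z).

Definition equivalent_trajectories (n hbar h1 h2 : nat)
    (M N : 'M[R]_(n, n + n + n)) : Prop :=
  forall phi x y : int -> 'cV[R]_n,
    generates hbar h1 h2 M phi x -> generates hbar h1 h2 N phi y ->
    forall k : nat, x k%:Z = y k%:Z.

(* Every history is continued by some trajectory, so that the quantification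
   in equivalent_trajectories is never vacuous. *)
Lemma generates_exists (n hbar h1 h2 : nat) (M : 'M[R]_(n, n + n + n))
    (phi : int -> 'cV[R]_n) : exists x, generates hbar h1 h2 M phi x.
Proof.
pose step (k : nat) (z : int -> 'cV[R]_n) (j : int) :=
  if j == k%:Z + 1 then M *m delayed_state h1 h2 z k%:Z else z j.
pose run := fix run k := if k is k'.+1 then step k' (run k') else phi.
have runS k j : j <= k%:Z -> run k.+1 j = run k j.
  by move=> jk; rewrite /= /step lt_eqF // ltzD1.
have runD k d j : j <= k%:Z -> run (k + d)%N j = run k j.
  move=> jk; elim: d => [|d IHd]; first by rewrite addn0.
  by rewrite addnS runS ?IHd // (le_trans jk) // lez_nat leq_addr.
pose x j := run `|j|%N j.
have xE (k : nat) j : j <= k%:Z -> x j = run k j.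
  case: j => [i|i] jk; rewrite /x.
    by rewrite -(subnKC (jk : (i <= k)%N)) runD.
  by rewrite -[k]add0n -[`|_|%N]add0n !runD.
exists x; split=> [j /andP[_ j0]|k]; first by rewrite (xE 0%N).
rewrite (xE k.+1) /= ?/step; last by rewrite addrC intS.
rewrite eqxx /delayed_state (xE k (_ - h1%:Z)) ?(xE k (_ - h2%:Z)) ?(xE k k%:Z) //.
  by rewrite lerBlDr lerDl.
by rewrite lerBlDr lerDl.
Qed.

End Delayed.

(* Main.v *)
(* By (3), X_1 G_K = [B A_1 A_0] W_0 G_K = [BK A_1 A_0], so (1) and (2) have the
   same system matrix, and the only question is whether (3) is solvable for
   every K. If W_0 has full row rank, a right inverse of W_0 solves it.
   Conversely, a left null vector [a b c] of W_0 also kills the left-hand side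
   of (3), which gives b = 0, c = 0 and aK = 0 for every K, hence a = 0 as
   n > 0. *)
Require Import Defs.
From mathcomp Require Import all_boot all_order all_algebra.
From mathcomp Require Import reals.

Import Order.TTheory GRing.Theory Num.Theory.
Local Open Scope ring_scope.

(** Since the delays do not exceed [hbar], the values read at a time [k >= 0] lie in the window from
    [-hbar] to [k]. Agreement on that window therefore extends by one time step. *)
Lemma generates_unique {R : realType} {n hbar h1 h2 : nat}
    {M : 'M[R]_(n, n + n + n)} {phi x y : int -> 'cV[R]_n} :
  (h1 <= hbar)%N -> (h2 <= hbar)%N ->
  generates hbar h1 h2 M phi x -> generates hbar h1 h2 M phi y ->
  forall j : int, - hbar%:Z <= j -> x j = y j.
Proof.
move=> hh1 hh2 [x0 xS] [y0 yS].
suff agree (k : nat) (j : int) : - hbar%:Z <= j -> j <= k%:Z -> x j = y j.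
  by move=> j lj; apply: (agree `|j|%N) => //; rewrite abszE ler_norm.
elim: k j => [|k IHk] j lj; first by move=> j0; rewrite x0 ?y0 ?lj.
rewrite le_eqVlt => /predU1P[->|]; last by rewrite intS addrC ltzD1; apply: IHk.
have past (h : nat) : (h <= hbar)%N -> x (k%:Z - h%:Z) = y (k%:Z - h%:Z).
  move=> hh; apply: IHk; last by rewrite lerBlDr lerDl.
  by rewrite -[leLHS]add0r lerB // lez_nat.
rewrite intS addrC xS yS /delayed_state (past h1 hh1) (past h2 hh2).
(* The undelayed state is the case of delay 0. *)
by rewrite -[k%:Z]subr0 (past 0%N).
Qed.

(** Multiplying by a matrix unit moves column [j] of [A] into the column of index 0, which exists
    because [0 < n]. *)
Lemma mulmx_eq0_forall {R : pzSemiRingType} {p m n : nat} (A : 'M[R]_(p, m)) :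
  (0 < n)%N -> (forall K : 'M[R]_(m, n), A *m K = 0) -> A = 0.
Proof.
move=> n_gt0 A0; apply/matrixP=> i j; rewrite mxE.
have /matrixP/(_ i (Ordinal n_gt0)) := A0 (delta_mx j (Ordinal n_gt0)).
rewrite !mxE (bigD1 j) //= mxE !eqxx mulr1 big1 ?addr0 // => l /negPf nlj.
by rewrite mxE nlj mulr0.
Qed.

Lemma row_free_solvable {F : fieldType} {m n p q T : nat}
    (W : 'M[F]_(m + p + q, T)) :
  (0 < n)%N ->
  (forall K : 'M[F]_(m, n), exists G : 'M[F]_(T, n + p + q),
     block_mx (block_mx K 0 0 1%:M) 0 0 1%:M = W *m G) <-> row_free W.
Proof.
move=> n_gt0; split=> [solv|freeW K]; last first.
  exists (pinvmx W *m block_mx (block_mx K 0 0 1%:M) 0 0 1%:M).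
  by rewrite mulmxA mulmxVp // mul1mx.
rewrite -kermx_eq0; apply/eqP.
(* The rows of [V] span all left null vectors of [W], so these are treated together; [a], [b], [c]
   are the column blocks of [V]. *)
move: (kermx W) (mulmx_ker W) => V VW.
rewrite -[V]hsubmxK -[lsubmx V]hsubmxK in VW *.
set a := lsubmx (lsubmx V) in VW *; set b := rsubmx _ in VW *.
set c := rsubmx V in VW *.
have abcK (K : 'M[F]_(m, n)) : row_mx (row_mx (a *m K) b) c = 0.
  have [G eqG] := solv K.
  have := congr1 (mulmx (row_mx (row_mx a b) c)) eqG.
  by rewrite mulmxA VW mul0mx !mul_row_block !(mulmx0, mulmx1, addr0, add0r).
(* The choice [K = 0] already settles [b] and [c]; the block [a] is then tested against every
   [K]. *)
have /eqP := abcK 0; rewrite !row_mx_eq0 => /andP[/andP[_ /eqP->] /eqP->].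
rewrite (mulmx_eq0_forall a n_gt0) ?row_mx0 // => K.
by have /eqP := abcK K; rewrite !row_mx_eq0 => /andP[/andP[/eqP]].
Qed.

(** Column [t] of the identity is the recorded equation at time [t], with its terms reordered. *)
Lemma data_mx_dynamics {R : realType} {n m T h1 h2 : nat}
    {A0 A1 : 'M[R]_n} {B : 'M[R]_(n, m)}
    {ud : int -> 'cV[R]_m} {xd : int -> 'cV[R]_n} :
  (forall k : nat, (k < T)%N ->
     xd (k%:Z + 1) =
       A0 *m xd k%:Z + A1 *m xd (k%:Z - h1%:Z) + B *m ud (k%:Z - h2%:Z)) ->
  data_mx T xd 1 =
    row_mx (row_mx B A1) A0 *m
      col_mx (col_mx (data_mx T ud (- h2%:Z)) (data_mx T xd (- h1%:Z)))
             (data_mx T xd 0).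
Proof.
move=> dyn; have col_data (p : nat) (z : int -> 'cV[R]_p) (s : int) (t : 'I_T) :
    col t (data_mx T z s) = z (t%:Z + s).
  by apply/colP=> i; rewrite !mxE.
(* Columns are compared as rows of the transposes. *)
apply/trmx_inj/row_matrixP=> t; rewrite -!tr_col; congr trmx.
rewrite [RHS]colE -mulmxA -colE !col_col_mx !col_data !mul_row_col addr0.
by rewrite dyn // addrC [X in _ + X = _]addrC addrA.
Qed.

Theorem lemma3p2 (R : realType) (n m hbar T h1 h2 : nat)
  (hn : (0 < n)%N) (hm : (0 < m)%N) (hhbar : (0 < hbar)%N) (hT : (hbar < T)%N)
  (hh1 : (h1 <= hbar)%N) (hh2 : (h2 <= hbar)%N)
  (A0 A1 : 'M[R]_n) (B : 'M[R]_(n, m))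
  (ud : int -> 'cV[R]_m) (xd : int -> 'cV[R]_n)
  (hdata : forall k : nat, (k < T)%N ->
     xd (k%:Z + 1) =
       A0 *m xd k%:Z + A1 *m xd (k%:Z - h1%:Z) + B *m ud (k%:Z - h2%:Z)) :
  let U0 : 'M[R]_(m, T) := data_mx T ud (- h2%:Z) in
  let X1 : 'M[R]_(n, T) := data_mx T xd 1 in
  let W0 : 'M[R]_(m + n + n, T) :=
    col_mx (col_mx U0 (data_mx T xd (- h1%:Z))) (data_mx T xd 0) in
  let eq3 (K : 'M[R]_(m, n)) (G : 'M[R]_(T, n + n + n)) : Prop :=
    block_mx (block_mx K 0 0 1%:M) 0 0 1%:M = W0 *m G in
  ((forall K : 'M[R]_(m, n),
      (exists G : 'M[R]_(T, n + n + n), eq3 K G) /\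
      (forall G : 'M[R]_(T, n + n + n), eq3 K G ->
         equivalent_trajectories hbar h1 h2
           (row_mx (row_mx (B *m K) A1) A0) (X1 *m G)))
   <-> \rank W0 = (m + 2 * n)%N)
  /\
  (forall (K : 'M[R]_(m, n)) (G : 'M[R]_(T, n + n + n)), eq3 K G ->
     forall (u : int -> 'cV[R]_m) (x : int -> 'cV[R]_n),
       (forall k : int, u k = K *m x k) ->
       forall k : int, u k = U0 *m G *m (row_mx (row_mx 1%:M 0) 0)^T *m x k).
Proof.
move=> U0 X1 W0 eq3.
have closed_loop K G : eq3 K G -> X1 *m G = row_mx (row_mx (B *m K) A1) A0.
  move=> eqG; rewrite /X1 (data_mx_dynamics hdata) -mulmxA -eqG.
  by rewrite !mul_row_block !(mulmx0, mulmx1, addr0, add0r).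
have rankE : \rank W0 = (m + 2 * n)%N <-> row_free W0.
  by rewrite /row_free mul2n -addnn addnA; split=> [->|/eqP].
split; last first.
  (* Right multiplication by [E] keeps the first block column of (3), that is [[K; 0; 0] = W0 G E],
     whose top block is [K = U0 G E]. *)
  move=> K G eqG u x ux k; set E := _^T.
  have /eq_col_mx[/eq_col_mx[KE _] _] :
      col_mx (col_mx K 0) 0 = col_mx (col_mx (U0 *m G *m E)
        (data_mx T xd (- h1%:Z) *m G *m E)) (data_mx T xd 0 *m G *m E).
    rewrite -!mul_col_mx -/W0 -eqG /E !tr_row_mx !trmx0 trmx1 !mul_block_col.
    by rewrite !(mulmx0, mul0mx, mulmx1, addr0).
  by rewrite -KE ux.
rewrite rankE -(row_free_solvable W0 hn); split=> [solv K|solv K].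
  by have [] := solv K.
split=> [|G eqG phi x y]; first exact: solv.
(* Both systems now have the same matrix, so their equivalence is the uniqueness of the trajectory
   with a given history. *)
rewrite (closed_loop K G eqG) => genx geny k.
by apply: (generates_unique hh1 hh2 genx geny); rewrite (le_trans (y := 0)) // oppr_le0.
Qed.
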